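(* Consider the LS-Boost$(\varepsilon)$ algorithm with learning rate $\varepsilon\in(0,1]$, producing iterates $\hat\beta^k$ and residuals $\hat r^k$, $k\ge 0$, and define $$\gamma := \left(1-\frac{\varepsilon(2-\varepsilon)\lambda_{\mathrm{pmin}}(\mathbf{X}^T\mathbf{X})}{4p}\right) < 1 .$$ Then for all $k\ge 0$ the following bounds hold: (i) (training error) $L_n(\hat\beta^k)-L_n^* \le \frac{1}{2n}\|\mathbf{X}\hat\beta_{LS}\|_2^2\cdot\gamma^k$; (ii) (regression coefficients) there exists a least squares solution $\hat\beta^k_{LS}$ such that $$\|\hat\beta^k-\hat\beta^k_{LS}\|_2 \le \frac{\|\mathbf{X}\hat\beta_{LS}\|_2}{\sqrt{\lambda_{\mathrm{pmin}}(\mathbf{X}^T\mathbf{X})}}\cdot\gamma^{k/2};$$ (iii) (predictions) for every least squares solution $\hat\beta_{LS}$, $$\|\mathbf{X}\hat\beta^k-\mathbf{X}\hat\beta_{LS}\|_2\le\|\mathbf{X}\hat\beta_{LS}\|_2\cdot\gamma^{k/2};$$ (iv) (gradient norm/correlation values) $\|\nabla L_n(\hat\beta^k)\|_\infty=\frac1n\|\mathbf{X}^T\hat r^k\|_\infty\le\frac1n\|\mathbf{X}\hat\beta_{LS}\|_2\cdot\gamma^{k/2}$; (v) ($\ell_1$-shrinkage of coefficients) $$\|\hat\beta^k\|_1\le\min\left\{\sqrt{k}\,\sqrt{\tfrac{\varepsilon}{2-\varepsilon}}\,\sqrt{\|\mathbf{X}\hat\beta_{LS}\|_2^2-\|\mathbf{X}\hat\beta_{LS}-\mathbf{X}\hat\beta^k\|_2^2}\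 ,\ \frac{\varepsilon\|\mathbf{X}\hat\beta_{LS}\|_2}{1-\sqrt{\gamma}}\left(1-\gamma^{k/2}\right)\right\};$$ (vi) (sparsity of coefficients) $\|\hat\beta^k\|_0\le k$.
   Context: Standing data: $\mathbf{X}=[\mathbf{X}_1,\ldots,\mathbf{X}_p]\in\mathbb{R}^{n\times p}$ is a real matrix with entries $x_{im}$, whose columns $\mathbf{X}_j$ each have zero mean and unit $\ell_2$ norm ($\|\mathbf{X}_j\|_2=1$), and $\mathbf{y}\in\mathbb{R}^n$ has zero mean. Least squares loss: $L_n(\beta):=\frac{1}{2n}\|\mathbf{y}-\mathbf{X}\beta\|_2^2$ for $\beta\in\mathbb{R}^p$, $L_n^*:=\min_{\beta\in\mathbb{R}^p}L_n(\beta)$. A least squares solution $\hat\beta_{LS}$ is any minimizer of $L_n$; the vector $\mathbf{X}\hat\beta_{LS}$ does not depend on which minimizer is chosen. $\lambda_{\mathrm{pmin}}(Q)$ denotes the smallest nonzero (hence positive) eigenvalue of a nonzero symmetric positive semidefinite matrix $Q$. $\|v\|_0$ is the number of nonzero entries of $v$. Algorithm LS-Boost$(\varepsilon)$: initialize $\hat r^0=\mathbf{y}$, $\hat\beta^0=0$. For $k=0,1,2,\ldots$: for each $m=1,\ldots,p$ let $\tilde u_m=\arg\min_{u\in\mathbb{R}}\sum_{i=1}^n(\hat r^k_i-x_{im}u)^2$, choose any $j_k\in\arg\min_{1\le m\le p}\sum_{i=1}^n(\hat r^k_i-x_{im}\tilde u_m)^2$, and set $\hat r^{k+1}=\hat r^k-\varepsilon\mathbf{X}_{j_k}\tilde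 u_{j_k}$, $\hat\beta^{k+1}_{j_k}=\hat\beta^k_{j_k}+\varepsilon\tilde u_{j_k}$, and $\hat\beta^{k+1}_j=\hat\beta^k_j$ for $j\ne j_k$. (The $\tilde u_m$ are recomputed at each iteration $k$.) *)

(* Defs.v *)
From HB Require Import structures.
From mathcomp Require Import all_boot all_order all_algebra.
From mathcomp Require Import all_classical all_reals all_analysis.

Set Implicit Arguments.
Unset Strict Implicit.
Unset Printing Implicit Defensive.

Import Order.TTheory GRing.Theory Num.Theory.
Import numFieldNormedType.Exports.

Local Open Scope classical_set_scope.
Local Open Scope ring_scope.

(* The sup norm is the library norm `|v| on matrices. *)
Definition l2norm (R : realType) (n : nat) (v : 'cV[R]_n) : R :=
  Num.sqrt (\sum_i v i 0 ^+ 2).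

Definition l1norm (R : realType) (n : nat) (v : 'cV[R]_n) : R :=
  \sum_i `|v i 0|.

Definition l0norm (R : realType) (n : nat) (v : 'cV[R]_n) : nat :=
  #|[set i | v i 0 != 0]%SET|.

Definition mean (R : realType) (n : nat) (v : 'cV[R]_n) : R :=
  (\sum_i v i 0) / n%:R.

Definition minimizes (R : realType) (T : Type) (f : T -> R) (x : T) : Prop :=
  forall z, f x <= f z.

(* The least element of A, or 0 if A has none. *)
Definition set_min (R : realType) (A : set R) : R := xget 0 (A `&` lbound A).

Definition lambda_pmin (R : realType) (p : nat) (Q : 'M[R]_p) : R :=
  set_min [set a | eigenvalue Q a /\ a != 0].

Definition gradient (R : realType) (p : nat) (f : 'cV[R]_p -> R)
    (x : 'cV[R]_p) : 'cV[R]_p :=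
  \col_j 'D_(delta_mx j 0) f x.

Section LeastSquares.
Context {R : realType} {n p : nat} (X : 'M[R]_(n, p)) (y : 'cV[R]_n).

Definition ls_loss (b : 'cV[R]_p) : R :=
  (2 * n%:R)^-1 * l2norm (y - X *m b) ^+ 2.

Definition ls_min : R := set_min (range ls_loss).

Definition ls_solution (b : 'cV[R]_p) : Prop := minimizes ls_loss b.

Definition col_rss (r : 'cV[R]_n) (m : 'I_p) (u : R) : R :=
  \sum_i (r i 0 - X i m * u) ^+ 2.

(* A relation rather than a function, since ties in the choice of the index j
   may be broken arbitrarily. *)
Definition ls_boost_step (eps : R) (b : 'cV[R]_p) (r : 'cV[R]_n)
    (b' : 'cV[R]_p) (r' : 'cV[R]_n) : Prop :=
  exists (u : 'I_p -> R) (j : 'I_p),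
    [/\ forall m, minimizes (col_rss r m) (u m),
        minimizes (fun m => col_rss r m (u m)) j,
        r' = r - (eps * u j) *: col j X &
        b' j 0 = b j 0 + eps * u j /\
        forall i, i != j -> b' i 0 = b i 0].

Definition ls_boost (eps : R) (b : nat -> 'cV[R]_p) (r : nat -> 'cV[R]_n) :
    Prop :=
  [/\ r 0%N = y, b 0%N = 0 &
      forall k, ls_boost_step eps (b k) (r k) (b k.+1) (r k.+1)].

Definition ls_boost_rate (eps : R) : R :=
  1 - eps * (2 - eps) * lambda_pmin (X^T *m X) / (4 * p%:R).

End LeastSquares.

(* Main.v *)
Require Import Defs.
From HB Require Import structures.
From mathcomp Require Import all_boot all_order all_algebra.
From mathcomp Require Import all_classical all_reals all_analysis.
From mathcomp Require Import ring lra.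

Set Implicit Arguments.
Unset Strict Implicit.
Unset Printing Implicit Defensive.

Import Order.TTheory GRing.Theory Num.Theory.
Import numFieldNormedType.Exports.

Local Open Scope classical_set_scope.
Local Open Scope ring_scope.

(** Everything is driven by the prediction error e_k = X (bLS - b_k), where bLS
    is any least squares solution.  The residual r_k differs from e_k by the
    vector y - X bLS, which is orthogonal to all columns of X, so the algorithm
    picks its column and its step as if the residual were e_k.  For unit
    columns the best univariate fit on column m is the correlation
    c_m = (X^T e_k)_m, the chosen column j maximizes c_m ^+ 2, and the step
    subtracts eps * c_j times that column; hence
    |e_(k+1)|^2 = |e_k|^2 - eps (2 - eps) c_j^2  ([run_step]).

    The maximum c_j^2 is at least the average |X^T e_k|^2 / p, and
    |X^T e_k|^2 >= lambda |e_k|^2 with lambda = [lambda_pmin (X^T *m X)]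
    ([lambda_pmin_gram]).  So |e_k|^2 contracts by the factor
    1 - eps (2 - eps) lambda / p, which is at most the rate gamma
    ([greedy_contraction], [error_decay]).

    The spectral input is the gap |X w|^2 >= lambda |w|^2 for w in the row space
    of X ([lambda_pminP]).  The Rayleigh quotient attains a minimum mu on the
    unit sphere of the row space by compactness ([least_stretch]); criticality
    makes the minimizer an eigenvector for mu > 0, and every eigenvector of X^T X
    for a nonzero eigenvalue lies in the row space, so that mu is the smallest
    nonzero eigenvalue.

    The bounds follow.  The excess loss is |e_k|^2 / (2 n); the gradient is
    - X^T e_k / n and each correlation with a unit column is at most |e_k|; the
    row space component w of bLS - b_k has X w = e_k, so b_k + w is a least
    squares solution at distance at most |e_k| / sqrt lambda from b_k.  An
    iteration changes one coefficient, by eps * c_j, so k of them touch at most k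
    coefficients, and the l1 norm is at most the sum of the eps * |c_j|.
    Bounding this sum by Cauchy-Schwarz and the telescoping energy identity gives
    the first l1 bound; bounding each |c_j| by the decaying |e_k| and summing
    the geometric series gives the second. *)

(** * The Euclidean inner product *)

Definition dot (R : realType) (n : nat) (u v : 'cV[R]_n) : R :=
  \sum_i u i 0 * v i 0.

Section Dot.
Context {R : realType} {n : nat}.
Implicit Types (u v w : 'cV[R]_n) (c : R).

Lemma dotE u v : dot u v = (u^T *m v) 0 0.
Proof. by rewrite mxE; apply: eq_bigr => i _; rewrite mxE. Qed.

Lemma dotC u v : dot u v = dot v u.
Proof. by apply: eq_bigr => i _; rewrite mulrC. Qed.

Lemma dotDl u v w : dot (u + v) w = dot u w + dot v w.
Proof. by rewrite /dot -big_split /=; apply: eq_bigr => i _; rewrite mxE mulrDl. Qed.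

Lemma dotZl c u v : dot (c *: u) v = c * dot u v.
Proof. by rewrite /dot big_distrr /=; apply: eq_bigr => i _; rewrite mxE mulrA. Qed.

Lemma dotDr u v w : dot u (v + w) = dot u v + dot u w.
Proof. by rewrite dotC dotDl !(dotC _ u). Qed.

Lemma dotZr c u v : dot u (c *: v) = c * dot u v.
Proof. by rewrite dotC dotZl dotC. Qed.

Lemma dotNl u v : dot (- u) v = - dot u v.
Proof. by rewrite -scaleN1r dotZl mulN1r. Qed.

Lemma dotNr u v : dot u (- v) = - dot u v.
Proof. by rewrite dotC dotNl dotC. Qed.

Lemma dot0r u : dot u 0 = 0.
Proof. by rewrite -(scale0r 0) dotZr mul0r. Qed.

Definition dotD := (dotDl, dotDr, dotNl, dotNr, dotZl, dotZr).

Lemma dot_ge0 u : 0 <= dot u u.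
Proof. by apply: sumr_ge0 => i _; rewrite -expr2 sqr_ge0. Qed.

Lemma dot_eq0 u : (dot u u == 0) = (u == 0).
Proof.
apply/eqP/eqP => [u0|->]; last exact: dot0r.
apply/colP => i; rewrite mxE; apply/eqP; rewrite -sqrf_eq0 expr2; apply/eqP.
by apply: (psumr_eq0P _ u0) => // j _; rewrite -expr2 sqr_ge0.
Qed.

Lemma sqr_l2norm u : l2norm u ^+ 2 = dot u u.
Proof.
rewrite /l2norm sqr_sqrtr; first by apply: eq_bigr => i _; rewrite expr2.
by apply: sumr_ge0 => i _; rewrite sqr_ge0.
Qed.

Lemma l2norm_ge0 u : 0 <= l2norm u.
Proof. exact: sqrtr_ge0. Qed.

Lemma l2norm_le u c : 0 <= c -> dot u u <= c ^+ 2 -> l2norm u <= c.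
Proof.
by move=> c0; rewrite -sqr_l2norm ler_pXn2r // nnegrE // l2norm_ge0.
Qed.

Lemma l2normN u : l2norm (- u) = l2norm u.
Proof.
by rewrite /l2norm; congr Num.sqrt; apply: eq_bigr => i _; rewrite mxE sqrrN.
Qed.

End Dot.

Lemma dot_mulmxl (R : realType) (n p : nat) (X : 'M[R]_(n, p))
    (u : 'cV_p) (v : 'cV_n) :
  dot (X *m u) v = dot u (X^T *m v).
Proof. by rewrite !dotE trmx_mul mulmxA. Qed.

Lemma dot_mulmxr (R : realType) (n p : nat) (X : 'M[R]_(n, p))
    (u : 'cV_p) (v : 'cV_n) :
  dot v (X *m u) = dot (X^T *m v) u.
Proof. by rewrite dotC dot_mulmxl dotC. Qed.

(** * The normal equations *)

Lemma gram_mul_eq0 (R : realType) (n p : nat) (X : 'M[R]_(n, p)) (u : 'cV[R]_p) :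
  X^T *m (X *m u) = 0 -> X *m u = 0.
Proof.
by move=> h; apply/eqP; rewrite -dot_eq0 dot_mulmxl h dot0r.
Qed.

(** Over an ordered field X^T X and X have the same kernel, hence the same row
    space, and y^T X lies in the row space of X. *)
Lemma normal_eq_solvable (R : realType) (n p : nat) (X : 'M[R]_(n, p))
    (y : 'cV[R]_n) :
  exists b : 'cV[R]_p, X^T *m (X *m b) = X^T *m y.
Proof.
pose C := cokermx (X^T *m X).
have XC : X *m C = 0.
  apply/matrixP => i j; have /colP/(_ i) : X *m col j C = 0.
    by apply: gram_mul_eq0; rewrite mulmxA colE mulmxA mulmx_coker mul0mx.
  by rewrite colE mulmxA -colE !mxE.
have /submxP[D yD] : (y^T *m X <= X^T *m X)%MS.
  by rewrite submxE -/C -mulmxA XC mulmx0.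
exists D^T; apply: trmx_inj; rewrite !trmx_mul !trmxK.
by rewrite -mulmxA -yD.
Qed.

(** * The smallest nonzero eigenvalue of a Gram matrix *)

Definition row_space (R : realType) (n p : nat) (X : 'M[R]_(n, p)) :
    set 'cV[R]_p :=
  [set X^T *m c | c in setT].

Section SpectralGap.
Context {R : realType} {n p : nat}.
Implicit Types (X : 'M[R]_(n, p)).

Lemma sqnorm_mulmx_continuous m (C : 'M[R]_(p, m)) :
  continuous (fun x : 'rV[R]_p => dot (x *m C)^T (x *m C)^T).
Proof.
move=> x; apply: (@continuous_big R _ +%R 0 xpredT); first exact: add_continuous.
move=> i _ z.
have cz : {for z, continuous (fun x : 'rV[R]_p => (x *m C)^T i 0)}.
  rewrite (_ : (fun _ => _) = fun x : 'rV[R]_p => \sum_j x 0 j * C j i).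
    apply: (@continuous_big R _ +%R 0 xpredT); first exact: add_continuous.
    move=> j _ t.
    apply: (@continuousM R _ (fun x : 'rV[R]_p => x 0 j) (fun=> C j i)).
      exact: coord_continuous.
    exact: cst_continuous.
  by apply/funext => t; rewrite !mxE.
exact: (continuousM cz cz).
Qed.

(** The minimum of |X x|^2 over unit vectors x of the row space exists because
    this set is a closed subset of the cube [-1, 1]^p.  With points written as
    rows x, the sphere, the row space and the objective are all level sets or
    values of one family of continuous functions x |-> |x C|^2. *)
Lemma least_stretch X : X != 0 ->
  exists2 d : 'cV[R]_p, row_space X d /\ dot d d = 1 &
  forall w, row_space X w ->
    dot (X *m d) (X *m d) * dot w w <= dot (X *m w) (X *m w).
Proof.
move=> X0.
pose sphere := [set x : 'rV[R]_p | dot (x *m 1%:M)^T (x *m 1%:M)^T = 1].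
pose rowsp := [set x : 'rV[R]_p | dot (x *m cokermx X)^T (x *m cokermx X)^T = 0].
have rowspP x : rowsp x <-> row_space X x^T.
  rewrite /rowsp /=; split=> [/eqP|[c _ xc]].
    rewrite dot_eq0 trmx_eq0 -submxE => /submxP[D ->].
    by exists D^T => //; rewrite trmx_mul.
  apply/eqP; rewrite dot_eq0 trmx_eq0 -submxE; apply/submxP; exists c^T.
  by apply: trmx_inj; rewrite -xc trmx_mul trmxK.
have closed_level (m : nat) (C : 'M[R]_(p, m)) a :
    closed [set x : 'rV[R]_p | dot (x *m C)^T (x *m C)^T = a].
  apply: (@preimage_closed _ _ (fun x : 'rV[R]_p => dot (x *m C)^T (x *m C)^T)
    [set a]); last exact: closed_eq.
  by move=> x _; apply: sqnorm_mulmx_continuous.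
have cA : compact (sphere `&` rowsp).
  apply: (@subclosed_compact _ _
    [set v : 'rV[R]_p | forall i, `[(-1 : R), 1]%classic (v ord0 i)]).
  - by apply: closedI; apply: closed_level.
  - apply: (@rV_compact R p (fun=> `[-1, 1]%classic)).
    by move=> _; apply: segment_compact.
  - move=> x [+ _] i; rewrite /sphere /= mulmx1 /dot => x1.
    rewrite /= in_itv /= -ler_norml -(@ler_pXn2r _ 2) ?nnegrE //.
    rewrite expr1n real_normK ?num_real //.
    rewrite -x1 (bigD1 i) //= mxE -expr2 lerDl sumr_ge0 // => j _.
    by rewrite -expr2 sqr_ge0.
have scale w : row_space X w -> w != 0 ->
    (sphere `&` rowsp) ((l2norm w)^-1 *: w)^T.
  move=> [c _ wc] w0; split; last first.
    by apply/rowspP; exists ((l2norm w)^-1 *: c); rewrite // trmxK -scalemxAr wc.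
  rewrite /sphere /= mulmx1 trmxK !dotD mulrA -expr2 exprVn sqr_l2norm mulVf //.
  by rewrite dot_eq0.
have [c0 c0P] : exists c : 'cV[R]_n, X^T *m c != 0.
  apply: contrapT => /forallNP h; case/eqP: X0; apply: trmx_inj.
  rewrite trmx0; apply/matrixP => i j; have /negP := h (delta_mx j 0).
  by rewrite negbK -colE => /eqP/colP/(_ i); rewrite !mxE.
have A0 : sphere `&` rowsp !=set0.
  by eexists; apply: scale c0P; exists c0.
have fc : {within sphere `&` rowsp,
    continuous (fun x : 'rV[R]_p => dot (x *m X^T)^T (x *m X^T)^T)}.
  by apply: continuous_subspaceT; apply: sqnorm_mulmx_continuous.
have [x xA xmin] := EVT_min_rV A0 cA fc.
move: xA; rewrite inE => -[x1 /rowspP xr].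
exists x^T; first by split=> //; move: x1; rewrite /sphere /= mulmx1.
move=> w wX; have [w0|w0] := eqVneq w 0.
  by rewrite w0 mulmx0 !dot0r mulr0.
have := xmin ((l2norm w)^-1 *: w)^T; rewrite inE => /(_ (scale _ wX w0)).
rewrite !trmx_mul !trmxK -scalemxAr !dotD mulrA -expr2 exprVn sqr_l2norm.
by rewrite mulrC ler_pdivlMr // lt_def dot_eq0 w0 dot_ge0.
Qed.

Lemma set_min_eq (A : set R) (a : R) : A a -> lbound A a -> set_min A = a.
Proof.
move=> Aa lba; apply: xget_unique; first by split.
by move=> c [Ac lbc]; apply/le_anti; rewrite lbc //= lba.
Qed.

(** The spectral gap.  With d the minimizer and mu the minimum of the Rayleigh
    quotient on the row space, |X w|^2 - mu |w|^2 is a nonnegative quadratic form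
    there that vanishes at d, so its polar form at d vanishes too: the vector
    g = X^T X d - mu d, which lies in the row space, is zero. *)
Lemma lambda_pminP X : X != 0 ->
  0 < lambda_pmin (X^T *m X) /\
  forall w, row_space X w ->
    lambda_pmin (X^T *m X) * dot w w <= dot (X *m w) (X *m w).
Proof.
move=> /least_stretch[d [[c _ dc] d1]]; set mu := dot (X *m d) (X *m d) => gap.
have mu0 : 0 < mu.
  rewrite lt_def dot_ge0 andbT dot_eq0; apply/eqP => Xd0; move: d1.
  rewrite -{2}dc dot_mulmxr trmxK Xd0 dotC dot0r => /eqP.
  by rewrite eq_sym oner_eq0.
have [g gdef] : exists g, g = X^T *m (X *m d) - mu *: d by eexists.
have gX : row_space X g.
  by exists (X *m d - mu *: c); rewrite // gdef mulmxBr -scalemxAr dc.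
have gE : dot (X *m d) (X *m g) - mu * dot d g = dot g g.
  by rewrite dot_mulmxr -dotZl -dotNl -dotDl gdef.
(* Otherwise the form, which is 2 s |g|^2 + s^2 Q at d + s g, would be negative
   for small s < 0; the choice of s makes the linear term dominate. *)
have g0 : g = 0.
  apply/eqP; rewrite -dot_eq0; apply: contraT => gn0.
  have a0 : 0 < dot g g by rewrite lt_def gn0 dot_ge0.
  pose Q := dot (X *m g) (X *m g) - mu * dot g g.
  have Q0 : 0 <= Q by rewrite subr_ge0; apply: gap.
  have [s sdef] : exists s, s = - dot g g / (Q + 1) by eexists.
  have [c' _ gc'] := gX.
  have /gap : row_space X (d + s *: g).
    by exists (c + s *: c'); rewrite // mulmxDr -scalemxAr dc gc'.
  rewrite mulmxDr -scalemxAr !dotD -/mu d1 (dotC g d) (dotC (X *m g) (X *m d)).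
  rewrite -subr_ge0 => h.
  have : 0 <= s * (2 * dot g g + s * Q).
    rewrite -gE; apply: le_trans h _; rewrite le_eqVlt; apply/orP; left; apply/eqP.
    by rewrite /Q; ring.
  have -> : s * (2 * dot g g + s * Q) = - (dot g g / (Q + 1)) ^+ 2 * (Q + 2).
    by rewrite sdef; field; rewrite gt_eqF // ltr_wpDl.
  by rewrite leNgt mulNr oppr_lt0 mulr_gt0 ?exprn_gt0 ?divr_gt0 ?ltr_wpDl //.
have eigd : X^T *m (X *m d) = mu *: d by apply/eqP; rewrite -subr_eq0 -gdef g0.
suff -> : lambda_pmin (X^T *m X) = mu by [].
apply: set_min_eq => [|a [/eigenvalueP[v va v0] a0]].
  split; last by rewrite gt_eqF.
  apply/eigenvalueP; exists d^T.
    apply: trmx_inj; rewrite !trmx_mul !trmxK -mulmxA eigd.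
    by apply/matrixP => i j; rewrite !mxE.
  by rewrite trmx_eq0 -dot_eq0 d1 oner_eq0.
have {}va : X^T *m (X *m v^T) = a *: v^T.
  apply: trmx_inj; rewrite !trmx_mul !trmxK -mulmxA va.
  by apply/matrixP => i j; rewrite !mxE.
have vv0 : 0 < dot v^T v^T by rewrite lt_def dot_ge0 dot_eq0 trmx_eq0 v0.
rewrite -(ler_pM2r vv0) -(dotZr a) -va -dot_mulmxl; apply: gap.
(* An eigenvector v for a != 0 equals X^T (X v / a). *)
by exists (a^-1 *: (X *m v^T)); rewrite // -scalemxAr va scalerA mulVf // scale1r.
Qed.

Lemma row_space_lift X (v : 'cV[R]_p) :
  exists2 w, row_space X w & X *m w = X *m v.
Proof.
have [c] := normal_eq_solvable X^T v; rewrite trmxK => cP.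
by exists (X^T *m c); first by exists c.
Qed.

End SpectralGap.
(** The spectral gap for X^T on the range of X.  Replacing v by its row space
    component w does not change z = X v, and the gap for w turns
    0 <= |X^T z - mu w|^2 = |X^T z|^2 - 2 mu |z|^2 + mu^2 |w|^2 into the claim. *)
Lemma lambda_pmin_gram (R : realType) (n p : nat) (X : 'M[R]_(n, p))
    (v : 'cV[R]_p) :
  X != 0 ->
  lambda_pmin (X^T *m X) * dot (X *m v) (X *m v)
    <= dot (X^T *m (X *m v)) (X^T *m (X *m v)).
Proof.
move=> /lambda_pminP[]; set mu := lambda_pmin _ => mu0 gap.
have [w wX <-] := row_space_lift X v; have := gap _ wX.
set z := X *m w => muw.
have := dot_ge0 (X^T *m z - mu *: w).
have zE : dot (X^T *m z) w = dot z z by rewrite -dot_mulmxr.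
rewrite !dotD (dotC w (X^T *m z)) zE.
by have := ler_wpM2l (ltW mu0) muw; lra.
Qed.

Lemma lambda_pmin_lift (R : realType) (n p : nat) (X : 'M[R]_(n, p))
    (v : 'cV[R]_p) :
  X != 0 -> exists2 w, X *m w = X *m v &
    l2norm w <= l2norm (X *m v) / Num.sqrt (lambda_pmin (X^T *m X)).
Proof.
move=> /lambda_pminP[mu0 gap]; have [w wX wv] := row_space_lift X v.
exists w => //; apply: l2norm_le.
  by rewrite divr_ge0 ?l2norm_ge0 ?sqrtr_ge0.
rewrite exprMn exprVn sqr_l2norm (sqr_sqrtr (ltW mu0)) -wv ler_pdivlMr // mulrC.
exact: gap.
Qed.

(** * The least squares loss *)

Section LeastSquares.
Context {R : realType} {n p : nat} (X : 'M[R]_(n, p)) (y : 'cV[R]_n).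

(** The exact second order expansion of the loss: it yields the
    characterization of minimizers, the excess loss and the gradient. *)
Lemma ls_loss_shift (b d : 'cV[R]_p) :
  ls_loss X y (b + d) = ls_loss X y b
    + n%:R^-1 * (dot (X *m d) (X *m d) / 2 - dot d (X^T *m (y - X *m b))).
Proof.
rewrite /ls_loss !sqr_l2norm mulmxDr opprD addrA -(dot_mulmxl X).
move: (y - X *m b) => r; rewrite !dotD (dotC r (X *m d)) invfM.
by move: (n%:R^-1) => N; field.
Qed.

Lemma ls_solutionP : (0 < n)%N -> forall b,
  ls_solution X y b <-> X^T *m (y - X *m b) = 0.
Proof.
move=> n0 b; have N0 : 0 < n%:R^-1 :> R by rewrite invr_gt0 ltr0n.
split=> [bmin|b0 z]; last first.
  rewrite -[z](subrKC b) ls_loss_shift b0 dot0r subr0 lerDl.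
  by rewrite mulr_ge0 ?divr_ge0 ?dot_ge0 // ltW.
have [b0] := normal_eq_solvable X y.
rewrite -[b0](subrKC b); set d := b0 - b => dE.
have gE : X^T *m (y - X *m b) = X^T *m (X *m d).
  by rewrite mulmxBr -dE !mulmxDr addrAC subrr add0r.
rewrite gE; have := bmin (b + d); rewrite ls_loss_shift gE -(dot_mulmxl X).
rewrite lerDl pmulr_rge0 // => h.
suff -> : X *m d = 0 by rewrite mulmx0.
by apply/eqP; rewrite -dot_eq0; apply/eqP; have := dot_ge0 (X *m d); lra.
Qed.

Lemma ls_solution_exists : (0 < n)%N -> exists b, ls_solution X y b.
Proof.
move=> n0; have [b bE] := normal_eq_solvable X y; exists b.
by apply/ls_solutionP => //; rewrite mulmxBr bE subrr.
Qed.

Lemma ls_min_solution b : ls_solution X y b -> ls_min X y = ls_loss X y b.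
Proof.
by move=> bmin; apply: set_min_eq => [|_ [z _ <-]]; [exists b | exact: bmin].
Qed.

Lemma gradient_ls_loss (b : 'cV[R]_p) :
  gradient (ls_loss X y) b = - n%:R^-1 *: (X^T *m (y - X *m b)).
Proof.
apply/colP => j; rewrite mxE [RHS]mxE /derive.
set v : 'cV[R]_p := delta_mx j 0.
have vE (u : 'cV[R]_p) : dot v u = u j 0.
  rewrite /dot (bigD1 j) //= !mxE !eqxx mul1r big1 ?addr0 // => i /negbTE ij.
  by rewrite mxE ij mul0r.
rewrite -vE; set a := dot v _; set q := n%:R^-1 * (dot (X *m v) (X *m v) / 2).
apply: cvg_lim => //.
apply: (@cvg_trans _ ((fun h : R => - n%:R^-1 * a + h * q) @ 0^')).
  apply: near_eq_cvg; near=> h.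
  have h0 : h != 0 by near: h; exact: nbhs_dnbhs_neq.
  rewrite /= [h *: v + b]addrC ls_loss_shift -scalemxAr !dotZl dotZr.
  rewrite -/a /GRing.scale /= /q.
  by move: (ls_loss _ _ _) (n%:R^-1) => L N; field.
have /continuous_withinNx : {for 0, continuous (fun h : R => - n%:R^-1 * a + h * q)}.
  apply: (@continuousD R R^o R (fun=> - n%:R^-1 * a) (fun h => h * q)).
    exact: cst_continuous.
  apply: (@continuousM R _ id (fun=> q)); first by move=> ?.
  exact: cst_continuous.
by rewrite mul0r addr0.
Unshelve. all: by end_near. Qed.

End LeastSquares.
(** * One boosting step *)

Section Boost.
Context {R : realType} {n p : nat} (X : 'M[R]_(n, p)) (y : 'cV[R]_n).
Hypothesis X_norm : forall j, l2norm (col j X) = 1.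

Lemma dot_col (j : 'I_p) : dot (col j X) (col j X) = 1.
Proof. by rewrite -sqr_l2norm X_norm expr1n. Qed.

Lemma corr_dot (j : 'I_p) (v : 'cV[R]_n) : (X^T *m v) j 0 = dot (col j X) v.
Proof. by rewrite !mxE; apply: eq_bigr => i _; rewrite !mxE. Qed.

Lemma sqnorm_sub_col (j : 'I_p) (v : 'cV[R]_n) (t : R) :
  dot (v - t *: col j X) (v - t *: col j X)
    = dot v v - (X^T *m v) j 0 ^+ 2 + (t - (X^T *m v) j 0) ^+ 2.
Proof. by rewrite corr_dot !dotD dot_col (dotC v (col j X)); ring. Qed.

(** Cauchy-Schwarz against a unit column, read off from the squared distance of
    v to its projection on that column. *)
Lemma corr_le (j : 'I_p) (v : 'cV[R]_n) : (X^T *m v) j 0 ^+ 2 <= dot v v.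
Proof.
have := dot_ge0 (v - (X^T *m v) j 0 *: col j X).
by rewrite sqnorm_sub_col subrr expr0n addr0 subr_ge0.
Qed.

Lemma sqnorm_gram_le (v : 'cV[R]_n) :
  dot (X^T *m v) (X^T *m v) <= p%:R * dot v v.
Proof.
rewrite mulr_natl -[p in _ *+ p]card_ord -sumr_const.
by apply: ler_sum => i _; rewrite -expr2 corr_le.
Qed.

Lemma design_neq0 : (0 < p)%N -> X != 0.
Proof.
move=> p0; apply/eqP => X0; have := dot_col (Ordinal p0).
by rewrite X0 col0 dot0r => /eqP; rewrite eq_sym oner_eq0.
Qed.

(** Testing the spectral gap on a single column.  This makes the rate
    positive, so that its square root and real powers have their usual meaning. *)
Lemma lambda_pmin_le_card : (0 < p)%N -> lambda_pmin (X^T *m X) <= p%:R.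
Proof.
move=> p0; set e : 'cV[R]_p := delta_mx (Ordinal p0) 0.
have := lambda_pmin_gram e (design_neq0 p0); rewrite -colE dot_col mulr1.
by move=> /le_trans -> //; rewrite (le_trans (sqnorm_gram_le _)) // dot_col mulr1.
Qed.

Lemma nb_samples_gt0 : (0 < p)%N -> (0 < n)%N.
Proof.
move=> p0; have := dot_col (Ordinal p0); rewrite /dot; case: n X => [X0|//].
by rewrite big_ord0 => /eqP; rewrite eq_sym oner_eq0.
Qed.

Lemma col_rssE (r : 'cV[R]_n) (m : 'I_p) (t : R) :
  col_rss X r m t = dot r r - (X^T *m r) m 0 ^+ 2 + (t - (X^T *m r) m 0) ^+ 2.
Proof.
rewrite -sqnorm_sub_col; apply: eq_bigr => i _.
by rewrite !mxE expr2 mulrC [X i m * t]mulrC.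
Qed.

(** On unit columns the univariate least squares coefficient is the correlation
    with the column, and the residual sum of squares it leaves is smallest where
    the squared correlation is largest. *)
Lemma ls_boost_stepP (eps : R) b r b' r' : ls_boost_step X eps b r b' r' ->
  exists j, let c := X^T *m r in
    [/\ forall m, c m 0 ^+ 2 <= c j 0 ^+ 2,
        r' = r - (eps * c j 0) *: col j X &
        b' = b + (eps * c j 0) *: delta_mx j 0].
Proof.
move=> [u [j [umin jmin -> [bj bi]]]]; exists j => /=.
have uE m : u m = (X^T *m r) m 0.
  have := umin m ((X^T *m r) m 0); rewrite !col_rssE subrr expr0n addr0 gerDl.
  by rewrite -[_ <= 0]andbT -(sqr_ge0 (u m - (X^T *m r) m 0)) => /le_anti/eqP;
    rewrite sqrf_eq0 subr_eq0 => /eqP.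
rewrite uE; split=> // [m|].
  have := jmin m; rewrite !col_rssE !uE !subrr expr0n !addr0.
  by rewrite lerD2l lerN2.
apply/colP => i; rewrite mxE [in X in _ + X]mxE [delta_mx _ _ _ _]mxE eqxx andbT.
have [->|ij] := eqVneq i j; first by rewrite bj uE mulr1.
by rewrite bi // mulr0 addr0.
Qed.

Section Rate.
Variable eps : R.
Hypotheses (p0 : (0 < p)%N) (eps_gt0 : 0 < eps) (eps_le1 : eps <= 1).
Let gamma := ls_boost_rate X eps.

Lemma ls_boost_rate_lt1 : gamma < 1.
Proof.
have [mu0 _] := lambda_pminP (design_neq0 p0).
rewrite /gamma /ls_boost_rate gtrBl divr_gt0 ?mulr_gt0 ?ltr0n //.
by rewrite subr_gt0 (le_lt_trans eps_le1) // ltr1n.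
Qed.

Lemma ls_boost_rate_gt0 : 0 < gamma.
Proof.
have P0 : 0 < p%:R :> R by rewrite ltr0n.
have [mu0 _] := lambda_pminP (design_neq0 p0).
have mup := lambda_pmin_le_card p0.
rewrite /gamma /ls_boost_rate subr_gt0 ltr_pdivrMr ?mulr_gt0 // mul1r.
have : eps * (2 - eps) * lambda_pmin (X^T *m X) <= 1 * p%:R.
  apply: ler_pM => //; last first.
  - by have := sqr_ge0 (1 - eps); rewrite expr2; lra.
  - exact: ltW.
  by rewrite mulr_ge0 ?subr_ge0 ?ltW // (le_lt_trans eps_le1) // ltr1n.
by lra.
Qed.

(** The largest squared correlation dominates the average of all p of them,
    which the spectral gap bounds from below by lambda |e|^2 / p; the rate keeps
    a quarter of this. *)
Lemma greedy_contraction (v : 'cV[R]_p) (j : 'I_p) :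
  let e := X *m v in let c := X^T *m e in
  (forall m, c m 0 ^+ 2 <= c j 0 ^+ 2) ->
  dot e e - eps * (2 - eps) * c j 0 ^+ 2 <= gamma * dot e e.
Proof.
move=> /= jmax; set e := X *m v.
have P0 : 0 < p%:R :> R by rewrite ltr0n.
have E0 : 0 <= eps * (2 - eps).
  by rewrite mulr_ge0 ?subr_ge0 ?ltW // (le_lt_trans eps_le1) // ltr1n.
have [mu0 _] := lambda_pminP (design_neq0 p0).
have cj : lambda_pmin (X^T *m X) / (4 * p%:R) * dot e e <= (X^T *m e) j 0 ^+ 2.
  rewrite mulrAC ler_pdivrMr ?mulr_gt0 //.
  apply: (le_trans (lambda_pmin_gram v (design_neq0 p0))).
  apply: (@le_trans _ _ (p%:R * (X^T *m e) j 0 ^+ 2)).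
    rewrite mulr_natl -[p in _ *+ p]card_ord -sumr_const.
    by apply: ler_sum => i _; rewrite -expr2 jmax.
  by have := mulr_ge0 (ltW P0) (sqr_ge0 ((X^T *m e) j 0)); lra.
rewrite /gamma /ls_boost_rate mulrBl mul1r lerB //.
by apply: le_trans (ler_wpM2l E0 cj); rewrite !mulrA.
Qed.

End Rate.
End Boost.
(** * The run of the algorithm *)

Section CoordinateUpdate.
Context {R : realType} {p : nat}.
Implicit Types (v : 'cV[R]_p) (a : R) (j : 'I_p).

Lemma l1norm_coord_update v a j :
  l1norm (v + a *: delta_mx j 0) <= l1norm v + `|a|.
Proof.
rewrite /l1norm (bigD1 j) //= [in leRHS](bigD1 j) //= addrAC.
rewrite !mxE !eqxx mulr1 lerD ?ler_normD // ler_sum // => i /negbTE ij.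
by rewrite !mxE ij mulr0 addr0.
Qed.

Lemma l0norm_coord_update v a j :
  (l0norm (v + a *: delta_mx j 0)%R <= (l0norm v).+1)%N.
Proof.
rewrite /l0norm; set S := [set i : 'I_p | v i 0 != 0]%SET.
have /subset_leq_card/leq_trans -> // :
    [set i : 'I_p | (v + a *: delta_mx j 0) i 0 != 0]%SET \subset (j |: S)%SET.
  apply/fintype.subsetP => i; rewrite !inE !mxE; have [//|ij] := eqVneq i j.
  by rewrite mulr0 addr0.
by rewrite cardsU1; case: (j \in S) => //; exact: leqW.
Qed.

End CoordinateUpdate.

(** The inductive step of Cauchy-Schwarz for sums: A is a sum of k terms whose
    squares add up to T, and t is the next term. *)
Lemma sqr_add_le (R : realType) (k : nat) (A t T : R) :
  0 <= A -> 0 <= t -> 0 <= T -> A ^+ 2 <= k%:R * T ->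
  (A + t) ^+ 2 <= k.+1%:R * (T + t ^+ 2).
Proof.
move=> A0 t0 T0 AT; have k0 : 0 <= k%:R :> R by rewrite ler0n.
have cross : 2 * A * t <= T + k%:R * t ^+ 2.
  rewrite -(@ler_pXn2r _ 2) ?nnegrE ?addr_ge0 ?mulr_ge0 ?sqr_ge0 //.
  have := sqr_ge0 (T - k%:R * t ^+ 2).
  have := ler_wpM2r (sqr_ge0 t) AT.
  lra.
by rewrite -natr1; lra.
Qed.

Section Run.
Context {R : realType} {n p : nat} (X : 'M[R]_(n, p)) (y : 'cV[R]_n) (eps : R).
Variables (b : nat -> 'cV[R]_p) (r : nat -> 'cV[R]_n) (bLS : 'cV[R]_p).
Hypotheses (X_norm : forall j, l2norm (col j X) = 1).
Hypotheses (p0 : (0 < p)%N) (eps_gt0 : 0 < eps) (eps_le1 : eps <= 1).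
Hypotheses (run : ls_boost X y eps b r) (bLS_sol : ls_solution X y bLS).

Let e k : 'cV[R]_n := X *m (bLS - b k).
Let M : R := l2norm (X *m bLS).
Let gamma := ls_boost_rate X eps.
Let s := Num.sqrt gamma.

Lemma residualE k : r k = y - X *m b k.
Proof.
case: run => r0 b0 step; elim: k => [|k IH].
  by rewrite r0 b0 mulmx0 subr0.
have [j [_ -> ->]] := ls_boost_stepP X_norm (step k).
by move: (eps * _) => c; rewrite IH mulmxDr -scalemxAr -colE opprD addrA.
Qed.

(** The final least squares residual y - X bLS is orthogonal to every column, so
    the algorithm cannot tell the current residual from the prediction error. *)
Lemma corr_residual k : X^T *m r k = X^T *m e k.
Proof.
have h := (ls_solutionP X y (nb_samples_gt0 X_norm p0) bLS).1 bLS_sol.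
have -> : r k = (y - X *m bLS) + e k by rewrite residualE /e mulmxBr addrA subrK.
by rewrite mulmxDr h add0r.
Qed.

Lemma prediction_errorE k : X *m b k - X *m bLS = - e k.
Proof. by rewrite /e mulmxBr opprB. Qed.

Lemma error0 : dot (e 0%N) (e 0%N) = M ^+ 2.
Proof. by case: run => _ b0 _; rewrite /e b0 subr0 /M sqr_l2norm. Qed.

Lemma run_step k : exists j, let c := (X^T *m e k) j 0 in
  [/\ dot (e k.+1) (e k.+1) = dot (e k) (e k) - eps * (2 - eps) * c ^+ 2,
      dot (e k.+1) (e k.+1) <= gamma * dot (e k) (e k) &
      b k.+1 = b k + (eps * c) *: delta_mx j 0].
Proof.
case: run => _ _ /(_ k)/(ls_boost_stepP X_norm)[j].
rewrite corr_residual => -[jmax _ bS]; exists j => /=.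
set c := (X^T *m e k) j 0 in bS *.
have eS : e k.+1 = e k - (eps * c) *: col j X.
  by rewrite /e bS opprD addrA mulmxBr -scalemxAr -colE.
have ES : dot (e k.+1) (e k.+1) = dot (e k) (e k) - eps * (2 - eps) * c ^+ 2.
  by rewrite eS sqnorm_sub_col // -/c; ring.
by split=> //; rewrite ES; apply: greedy_contraction.
Qed.

Lemma gamma_powE k : gamma `^ (k%:R / 2) = s ^+ k.
Proof.
rewrite mulrC powRrM powR12_sqrt ?powR_mulrn ?sqrtr_ge0 //.
exact/ltW/ls_boost_rate_gt0.
Qed.

Lemma sqr_s : s ^+ 2 = gamma.
Proof. by rewrite sqr_sqrtr // ltW // ls_boost_rate_gt0. Qed.

Lemma s_lt1 : s < 1.
Proof. by rewrite -sqrtr1 ltr_sqrt // ls_boost_rate_lt1. Qed.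

Lemma error_decay k : dot (e k) (e k) <= M ^+ 2 * gamma ^+ k.
Proof.
elim: k => [|k IH]; first by rewrite error0 expr0 mulr1.
have [j /= [_ le_gamma _]] := run_step k; apply: (le_trans le_gamma).
rewrite [gamma ^+ _]exprS mulrCA ler_wpM2l //.
exact/ltW/ls_boost_rate_gt0.
Qed.

Lemma error_norm_decay k : l2norm (e k) <= M * s ^+ k.
Proof.
have M0 : 0 <= M by exact: l2norm_ge0.
apply: l2norm_le; first by rewrite mulr_ge0 ?exprn_ge0 ?sqrtr_ge0.
by rewrite exprMn exprAC sqr_s error_decay.
Qed.

Lemma corr_norm_decay k j : `|(X^T *m e k) j 0| <= M * s ^+ k.
Proof.
apply: le_trans (error_norm_decay k).
rewrite -(@ler_pXn2r _ 2) ?nnegrE ?l2norm_ge0 //.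
by rewrite sqr_l2norm real_normK ?num_real // corr_le.
Qed.

(** The factor of k is the sum of the (eps * c_j)^2 over the first k steps,
    which telescopes by the energy identity of [run_step]. *)
Lemma coef_l1_energy k :
  l1norm (b k) ^+ 2 <= k%:R * (eps / (2 - eps) * (M ^+ 2 - dot (e k) (e k))).
Proof.
have e2 : 0 < 2 - eps by rewrite subr_gt0 (le_lt_trans eps_le1) // ltr1n.
elim: k => [|k IH].
  case: run => _ -> _; rewrite /l1norm mul0r big1 ?expr0n // => i _.
  by rewrite mxE normr0.
have [j /= [-> _ ->]] := run_step k; set c := (X^T *m e k) j 0.
move: IH; set T := eps / (2 - eps) * (M ^+ 2 - _); set A := l1norm (b k) => IH.
have T0 : 0 <= T.
  rewrite mulr_ge0 ?divr_ge0 ?(ltW eps_gt0) ?(ltW e2) // subr_ge0.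
  rewrite (le_trans (error_decay k)) //.
  rewrite ler_piMr ?sqr_ge0 // exprn_ile1 // ltW //.
    exact: ls_boost_rate_gt0.
  exact: ls_boost_rate_lt1.
have -> : eps / (2 - eps)
    * (M ^+ 2 - (dot (e k) (e k) - eps * (2 - eps) * c ^+ 2)) = T + (eps * c) ^+ 2.
  by rewrite /T; field; rewrite gt_eqF.
have A0 : 0 <= A by apply: sumr_ge0.
set a := eps * c.
apply: (@le_trans _ _ ((A + `|a|) ^+ 2)).
  rewrite ler_pXn2r ?nnegrE ?addr_ge0 //; first exact: l1norm_coord_update.
  exact: sumr_ge0.
by rewrite -(@real_normK _ a) ?num_real //; exact: sqr_add_le.
Qed.

(** The right-hand side is the partial sum of the geometric series
    eps * M * s ^+ i for i < k, which bounds step i. *)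
Lemma coef_l1_geometric k : l1norm (b k) <= eps * M / (1 - s) * (1 - s ^+ k).
Proof.
have s1 := s_lt1.
elim: k => [|k IH].
  case: run => _ -> _; rewrite /l1norm expr0 subrr mulr0 big1 // => i _.
  by rewrite mxE normr0.
have [j /= [_ _ ->]] := run_step k; apply: le_trans (l1norm_coord_update _ _ _) _.
have -> : eps * M / (1 - s) * (1 - s ^+ k.+1)
    = eps * M / (1 - s) * (1 - s ^+ k) + eps * (M * s ^+ k).
  by rewrite exprS; field; rewrite subr_eq0 gt_eqF.
rewrite lerD // normrM (gtr0_norm eps_gt0) ler_wpM2l ?(ltW eps_gt0) //.
exact: corr_norm_decay.
Qed.

Lemma coef_l0 k : (l0norm (b k) <= k)%N.
Proof.
elim: k => [|k IH].
  case: run => _ -> _; rewrite leqn0 cards_eq0; apply/eqP/finset.setP => i.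
  by rewrite !inE mxE eqxx.
have [j /= [_ _ ->]] := run_step k.
exact: leq_trans (l0norm_coord_update _ _ _) _.
Qed.

End Run.

Theorem theorem2p1 (R : realType) (n p : nat)
    (X : 'M[R]_(n, p)) (y : 'cV[R]_n) (eps : R)
    (b : nat -> 'cV[R]_p) (r : nat -> 'cV[R]_n)
    (X_mean : forall j, mean (col j X) = 0)
    (X_norm : forall j, l2norm (col j X) = 1)
    (y_mean : mean y = 0)
    (eps_gt0 : 0 < eps) (eps_le1 : eps <= 1)
    (br_boost : ls_boost X y eps b r) :
  let gamma := ls_boost_rate X eps in
  [/\ gamma < 1,
      exists bLS, ls_solution X y bLS &
      forall (bLS : 'cV[R]_p), ls_solution X y bLS -> forall k : nat,
      [/\ (* training error *)
          ls_loss X y (b k) - ls_min X y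
            <= (2 * n%:R)^-1 * l2norm (X *m bLS) ^+ 2 * gamma ^+ k,
          (* regression coefficients *)
          exists bLSk, ls_solution X y bLSk /\
            l2norm (b k - bLSk)
              <= l2norm (X *m bLS) / Num.sqrt (lambda_pmin (X^T *m X))
                 * gamma `^ (k%:R / 2),
          (* predictions *)
          l2norm (X *m b k - X *m bLS)
            <= l2norm (X *m bLS) * gamma `^ (k%:R / 2) &
      [/\ (* gradient norm / correlation values *)
          `|gradient (ls_loss X y) (b k)| = n%:R^-1 * `|X^T *m r k| /\
          n%:R^-1 * `|X^T *m r k|
            <= n%:R^-1 * l2norm (X *m bLS) * gamma `^ (k%:R / 2),
          (* l1-shrinkage of coefficients *)
          l1norm (b k)
            <= Num.min
                 (Num.sqrt k%:R * Num.sqrt (eps / (2 - eps)) *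
                  Num.sqrt (l2norm (X *m bLS) ^+ 2
                            - l2norm (X *m bLS - X *m b k) ^+ 2))
                 (eps * l2norm (X *m bLS) / (1 - Num.sqrt gamma)
                  * (1 - gamma `^ (k%:R / 2))) &
          (* sparsity of coefficients *)
          (l0norm (b k) <= k)%N]]].
Proof.
move=> gamma.
have p0 : (0 < p)%N.
  by case: br_boost => _ _ /(_ 0%N)[_ [j _]]; apply: leq_ltn_trans (ltn_ord j).
have n0 := nb_samples_gt0 X_norm p0.
have N0 : 0 <= (2 * n%:R)^-1 :> R by rewrite invr_ge0 mulr_ge0.
split; [exact: ls_boost_rate_lt1 | exact: ls_solution_exists|].
move=> bLS sol k.
have powE := gamma_powE X_norm p0 eps_gt0 eps_le1 k; rewrite -/gamma in powE.
have normal := (ls_solutionP X y n0 bLS).1 sol.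
have corrE := corr_residual X_norm p0 br_boost sol k.
have lossE : ls_loss X y (b k) - ls_min X y
    = (2 * n%:R)^-1 * dot (X *m (bLS - b k)) (X *m (bLS - b k)).
  rewrite (ls_min_solution sol) -[b k](subrKC bLS) ls_loss_shift normal dot0r.
  rewrite subr0 addrAC subrr add0r -[bLS - _]opprB (addrC bLS) addrK mulmxN.
  by rewrite !dotD opprK invfM; ring.
split.
- rewrite lossE -mulrA ler_wpM2l //.
  exact: (error_decay X_norm p0 eps_gt0 eps_le1 br_boost sol k).
- have [w wX wle] := lambda_pmin_lift (bLS - b k) (design_neq0 X_norm p0).
  exists (b k + w); split.
    apply/ls_solutionP => //.
    suff -> : X *m (b k + w) = X *m bLS by exact: normal.
    by rewrite mulmxDr wX -mulmxDr addrC subrK.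
  rewrite opprD addrA subrr sub0r l2normN; apply: (le_trans wle).
  rewrite powE mulrAC ler_wpM2r ?invr_ge0 ?sqrtr_ge0 //.
  exact: (error_norm_decay X_norm p0 eps_gt0 eps_le1 br_boost sol k).
- rewrite prediction_errorE l2normN powE.
  exact: (error_norm_decay X_norm p0 eps_gt0 eps_le1 br_boost sol k).
split.
- split.
    by rewrite gradient_ls_loss -(residualE X_norm br_boost) normrZ normrN ger0_norm.
  rewrite -mulrA ler_wpM2l ?invr_ge0 // powE corrE.
  rewrite [leLHS]/Num.norm /= mx_normrE; apply: bigmax_le => [|[i j] _ /=].
    by rewrite mulr_ge0 ?l2norm_ge0 ?exprn_ge0 ?sqrtr_ge0.
  rewrite ord1.
  exact: (corr_norm_decay X_norm p0 eps_gt0 eps_le1 br_boost sol k i).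
- rewrite le_min; apply/andP; split.
    rewrite -[X in X <= _]ger0_norm ?sumr_ge0 // -sqrtr_sqr -!sqrtrM //.
    + rewrite ler_wsqrtr // -mulrA -[X *m bLS - _]opprB prediction_errorE.
      rewrite !l2normN !sqr_l2norm -(sqr_l2norm (X *m bLS)).
      exact: (coef_l1_energy X_norm p0 eps_gt0 eps_le1 br_boost sol k).
    + by rewrite mulr_ge0 // divr_ge0 ?ltW //; lra.
  rewrite powE; exact: (coef_l1_geometric X_norm p0 eps_gt0 eps_le1 br_boost sol k).
- exact: (coef_l0 X_norm p0 eps_gt0 eps_le1 br_boost sol k).
Qed.
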